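(* Let $n\geq 2$ and let $\Diamond:\mathcal{K}^n\to\mathcal{K}^n_s$ be an $o$-symmetrization. Then $\Diamond$ is continuous, $\mathrm{GL}(n)$-covariant and satisfies a Rogers-Shephard type inequality if and only if there is a real number $\lambda\geq 0$ such that $\Diamond K=\lambda DK$ for all $K\in\mathcal{K}^n$.
   Context: $\mathcal{K}^n$ denotes the set of convex bodies (nonempty compact convex sets, not necessarily with interior points) in $\mathbb{R}^n$, with the Hausdorff metric; continuity is with respect to this metric. $\mathcal{K}^n_s\subset\mathcal{K}^n$ is the subset of convex bodies $K$ symmetric with respect to the origin, i.e. $K=-K$. An $o$-symmetrization is any operator $\Diamond:\mathcal{K}^n\to\mathcal{K}^n_s$. The difference body of $K$ is $DK=K+(-K)$ (Minkowski sum), where $-K=\{-x:x\in K\}$. $\mathrm{Vol}$ is $n$-dimensional Lebesgue measure. The operator $\Diamond$ is $\mathrm{GL}(n)$-covariant if $\Diamond(gK)=g\,\Diamond K$ for all $K\in\mathcal{K}^n$ and all $g\in\mathrm{GL}(n)$. It satisfies a Rogers-Shephard type inequality if there is a constant $C>0$ such that $\mathrm{Vol}(\Diamond K)\leq C\,\mathrm{Vol}(K)$ for all $K\in\mathcal{K}^n$. *)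

(* Defs.v *)
From HB Require Import structures.
From mathcomp Require Import all_boot all_order all_algebra.
From mathcomp Require Import all_classical all_reals all_analysis.

Set Implicit Arguments.
Unset Strict Implicit.
Unset Printing Implicit Defensive.

Import Order.TTheory GRing.Theory Num.Theory.
Import numFieldNormedType.Exports.

Local Open Scope classical_set_scope.
Local Open Scope ring_scope.

Definition set_scale (R : realType) (n : nat) (a : R) (A : set 'cV[R]_n) :
  set 'cV[R]_n := [set a *: x | x in A].

Definition set_opp (R : realType) (n : nat) (A : set 'cV[R]_n) :
  set 'cV[R]_n := [set - x | x in A].

Definition minkowski_sum (R : realType) (n : nat) (A B : set 'cV[R]_n) :
  set 'cV[R]_n := [set x + y | x in A & y in B].

Definition difference_body (R : realType) (n : nat) (K : set 'cV[R]_n) :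
  set 'cV[R]_n := minkowski_sum K (set_opp K).

Definition convex_bodies (R : realType) (n : nat) : set (set 'cV[R]_n) :=
  [set K : set 'cV[R]_n | [/\ K !=set0, compact K & convex_set K]].

Definition symmetric_convex_bodies (R : realType) (n : nat) :
  set (set 'cV[R]_n) :=
  [set K : set 'cV[R]_n | convex_bodies K /\ K = set_opp K].

(* The library's norm on matrices is the sup norm, so the Euclidean ball has to
   be introduced separately. *)
Definition euclidean_norm (R : realType) (n : nat) (x : 'cV[R]_n) : R :=
  Num.sqrt (\sum_(i < n) x i 0 ^+ 2).

Definition euclidean_ball (R : realType) (n : nat) (r : R) : set 'cV[R]_n :=
  [set x | euclidean_norm x <= r].

Definition hausdorff_dist (R : realType) (n : nat) (K L : set 'cV[R]_n) : R :=
  inf [set r : R | [/\ 0 <= r,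
    K `<=` minkowski_sum L (euclidean_ball r) &
    L `<=` minkowski_sum K (euclidean_ball r)]].

Definition closed_box (R : realType) (n : nat) (a b : 'cV[R]_n) :
  set 'cV[R]_n := [set x | forall i, a i 0 <= x i 0 <= b i 0].

(* n-dimensional Lebesgue (outer) measure: the infimum of the total volume of
   the countable covers by boxes. On Lebesgue measurable sets, in particular on
   compact ones, it is the Lebesgue measure. *)
Definition Vol (R : realType) (n : nat) (A : set 'cV[R]_n) : \bar R :=
  ereal_inf [set v : \bar R | exists a b : nat -> 'cV[R]_n,
    [/\ forall k i, a k i 0 <= b k i 0,
        A `<=` \bigcup_k closed_box (a k) (b k) &
        v = (\sum_(0 <= k <oo) (\prod_(i < n) (b k i 0 - a k i 0))%:E)%E]].

(* An o-symmetrization is an element of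
   {fun @convex_bodies R n >-> @symmetric_convex_bodies R n}: its values outside
   convex_bodies are irrelevant, and the properties below never look at them. *)

Definition hausdorff_continuous (R : realType) (n : nat)
    (F : set 'cV[R]_n -> set 'cV[R]_n) : Prop :=
  forall K, convex_bodies K -> forall e : R, 0 < e ->
  exists2 d : R, 0 < d & forall L, convex_bodies L ->
    hausdorff_dist K L < d -> hausdorff_dist (F K) (F L) < e.

Definition GL_covariant (R : realType) (n : nat)
    (F : set 'cV[R]_n -> set 'cV[R]_n) : Prop :=
  forall K, convex_bodies K -> forall g : 'M[R]_n, g \in unitmx ->
    F [set g *m x | x in K] = [set g *m x | x in F K].

Definition rogers_shephard_type (R : realType) (n : nat)
    (F : set 'cV[R]_n -> set 'cV[R]_n) : Prop :=
  exists2 C : R, 0 < C & forall K, convex_bodies K ->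
    (Vol (F K) <= C%:E * Vol K)%E.

(* Main.v *)
(** For a continuous covariant symmetrization F, covariance extends to singular
    matrices, and rank one matrices x |-> w(x) e show that the support function
    h(FK, w) depends only on the interval w(K) = [a, b]; write it G(a, b).
    Taking for K a segment with linearly independent endpoints, G is a seminorm
    on R^2, invariant under exchange of a and b.  A body in an affine hyperplane
    avoiding 0 has volume 0, so its image spans no neighbourhood of 0, and hence
    G has a nontrivial kernel, which contains (1, 1) or (1, -1).  In the second
    case G(a, b) is a multiple of |a + b|, and convexity of the support function
    of the image of a triangle forces G = 0.  So G(a, b) = lambda |b - a|, which
    is the support function of lambda DK.

    Conversely, the Rogers-Shephard type inequality for lambda DK is proved with
    a non-optimal constant and without computing volumes: by elimination with
    pivoting, K contains v and v + u_1, ..., v + u_n and lies in the set of the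
    v + sum_k s_k u_k with |s_k| <= c, for a constant c depending only on n;
    then a number of translates of K that depends only on n and lambda covers
    lambda DK. *)

Require Import Defs.
From mathcomp Require Import all_boot all_order all_algebra.
From mathcomp Require Import all_classical all_reals all_analysis.
From mathcomp Require Import measurable_realfun.
From mathcomp Require Import ring lra.

Set Implicit Arguments.
Unset Strict Implicit.
Unset Printing Implicit Defensive.

Import Order.TTheory GRing.Theory Num.Theory.
Import numFieldNormedType.Exports.

Local Open Scope classical_set_scope.
Local Open Scope ring_scope.

(** * Convex bodies and linear forms *)

Section ConvexBodies.
Variable R : realType.
Implicit Types n m : nat.

Lemma convex_setP n (K : set 'cV[R]_n) :
  convex_set K <-> forall x y t, K x -> K y -> 0 <= t <= 1 ->
    K (t *: x + (1 - t) *: y).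
Proof.
split=> [cK x y t Kx Ky /andP[t0 t1]|cK x y t].
  pose l : {i01 R} := Itv01 t0 t1.
  have := cK x y l; rewrite !inE => /(_ Kx Ky); exact.
rewrite !inE => Kx Ky; apply: cK => //; apply/andP; split; exact.
Qed.

Lemma mx_continuous (T : topologicalType) m n (f : T -> 'M[R]_(m, n)) :
  (forall i j, continuous (fun x => f x i j)) -> continuous f.
Proof.
move=> cf x A [P fP PA]; rewrite /nbhs /=.
apply: filterS (fun y => PA (f y)) _.
by apply: filter_forall => i; apply: filter_forall => j; exact: cf (fP i j).
Qed.

Lemma continuous_sum (T : topologicalType) (I : finType) (f : I -> T -> R) :
  (forall i, continuous (f i)) -> continuous (fun x => \sum_i f i x).
Proof.
move=> cf; apply: continuous_big => [|i _]; last exact: cf.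
exact: (@add_continuous R^o).
Qed.

Lemma mulmx_continuous m n (g : 'M[R]_(m, n)) :
  continuous (fun x : 'cV[R]_n => g *m x).
Proof.
apply: mx_continuous => i j.
have -> : (fun x : 'cV[R]_n => (g *m x) i j) =
          (fun x => \sum_k g i k * x k j) by apply/funext => x; rewrite mxE.
apply: continuous_sum => k x.
apply: (@continuousM _ _ (cst (g i k)) (fun x : 'cV[R]_n => x k j)).
  exact: cst_continuous.
exact: coord_continuous.
Qed.

Lemma compact_closed_mx m n (K : set 'M[R]_(m, n)) : compact K -> closed K.
Proof. by apply: compact_closed; exact: norm_hausdorff. Qed.

Lemma closed_approx m n (K : set 'M[R]_(m, n)) (x : 'M[R]_(m, n)) :
  closed K -> (forall e, 0 < e -> exists2 y, K y & `|x - y| < e) -> K x.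
Proof.
move=> cK xK; apply: cK => A /nbhs_ballP[e /= e0 eA].
have [y Ky xy] := xK e e0; exists y; split=> //; apply: eA.
by rewrite -ball_normE.
Qed.

Lemma closed_preimage n (f : 'cV[R]_n -> R) (D : set R) :
  continuous f -> closed D -> closed (f @^-1` D).
Proof. by move=> cf cD; apply: closed_comp => // x _; exact: cf. Qed.

Lemma mx_norm_le m n (x : 'M[R]_(m, n)) r : 0 <= r ->
  (forall i j, `|x i j| <= r) -> `|x| <= r.
Proof.
move=> r0 xr; rewrite [leLHS]/Num.Def.normr /= mx_normrE.
by apply/bigmax_leP; split=> // -[i j] _; exact: xr.
Qed.

Lemma le_mx_norm m n (x : 'M[R]_(m, n)) i j : `|x i j| <= `|x|.
Proof.
rewrite [leRHS]/Num.Def.normr /= mx_normrE.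
by apply/bigmax_geP; right; exists (i, j).
Qed.

Lemma compact_bound m n (K : set 'M[R]_(m, n)) : compact K ->
  exists2 M, 0 < M & forall x, K x -> `|x| <= M.
Proof.
move=> /compact_bounded[M [_ MK]]; exists (`|M| + 1) => [|x Kx].
  by rewrite ltr_wpDl.
by apply: MK Kx; rewrite ltr_pwDr// ler_norm.
Qed.

(** [rV_compact] speaks of row vectors, so [K] is placed as a closed subset in the transpose of a
    compact cube of row vectors. *)
Lemma bounded_closed_compact_cV n (K : set 'cV[R]_n) (M : R) :
  closed K -> (forall x i, K x -> `|x i 0| <= M) -> compact K.
Proof.
move=> cK KM.
have cT : continuous (fun x : 'rV[R]_n => x^T).
  apply: mx_continuous => i j; under eq_fun do rewrite mxE.
  exact: coord_continuous.
pose B : set 'rV[R]_n := [set v | forall i, `[- M, M]%classic (v ord0 i)].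
have cB : compact B.
  apply: (@rV_compact _ _ (fun=> `[- M, M]%classic)) => i.
  exact: segment_compact.
apply: (@subclosed_compact _ _ [set x^T | x in B]) => //.
  by apply: continuous_compact => //; exact: continuous_subspaceT.
move=> x Kx; exists x^T; last by rewrite trmxK.
by move=> i /=; rewrite mxE in_itv /= -ler_norml; exact: KM.
Qed.

Definition lform n (w : 'rV[R]_n) (x : 'cV[R]_n) : R := (w *m x) 0 0.

Lemma lformE n (w : 'rV[R]_n) x : lform w x = \sum_i w 0 i * x i 0.
Proof. by rewrite /lform mxE. Qed.

Lemma lformD n (w : 'rV[R]_n) x y : lform w (x + y) = lform w x + lform w y.
Proof. by rewrite /lform mulmxDr mxE. Qed.

Lemma lformZ n (w : 'rV[R]_n) a x : lform w (a *: x) = a * lform w x.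
Proof. by rewrite /lform -scalemxAr mxE. Qed.

Lemma lformN n (w : 'rV[R]_n) x : lform w (- x) = - lform w x.
Proof. by rewrite /lform mulmxN mxE. Qed.

Lemma lformDl n (v w : 'rV[R]_n) x : lform (v + w) x = lform v x + lform w x.
Proof. by rewrite /lform mulmxDl mxE. Qed.

Lemma lformZl n (w : 'rV[R]_n) a x : lform (a *: w) x = a * lform w x.
Proof. by rewrite /lform -scalemxAl mxE. Qed.

Lemma lform_continuous n (w : 'rV[R]_n) : continuous (lform w).
Proof.
move=> x; apply: (@continuous_comp _ _ _ (fun x : 'cV[R]_n => w *m x)
  (fun y : 'M[R]_1 => y 0 0)).
  exact: mulmx_continuous.
exact: coord_continuous.
Qed.

Lemma compact_max n (K : set 'cV[R]_n) (f : 'cV[R]_n -> R) :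
  K !=set0 -> compact K -> continuous f ->
  exists2 x, K x & forall y, K y -> f y <= f x.
Proof.
move=> K0 cK cf; have [|x] := @compact_EVT_max _ _ f _ K0 cK.
  exact: continuous_subspaceT.
rewrite inE => Kx xm; exists x => // y Ky; apply: xm; exact/mem_set.
Qed.

Lemma compact_min n (K : set 'cV[R]_n) (f : 'cV[R]_n -> R) :
  K !=set0 -> compact K -> continuous f ->
  exists2 x, K x & forall y, K y -> f x <= f y.
Proof.
move=> K0 cK cf; have [|x] := @compact_EVT_min _ _ f _ K0 cK.
  exact: continuous_subspaceT.
rewrite inE => Kx xm; exists x => // y Ky; apply: xm; exact/mem_set.
Qed.

Lemma convex_body_image m n (g : 'M[R]_(m, n)) (K : set 'cV[R]_n) :
  convex_bodies K -> convex_bodies [set g *m x | x in K].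
Proof.
move=> [[x0 Kx0] cK /convex_setP xK]; split.
- by exists (g *m x0), x0.
- apply: continuous_compact => //; apply: continuous_subspaceT.
  exact: mulmx_continuous.
- apply/convex_setP => _ _ t [x Kx <-] [y Ky <-] t01.
  by exists (t *: x + (1 - t) *: y); [exact: xK | rewrite mulmxDr !scalemxAr].
Qed.

Lemma convex_body_difference n (K : set 'cV[R]_n) :
  convex_bodies K -> convex_bodies (difference_body K).
Proof.
move=> [[x0 Kx0] cK /convex_setP xK]; split.
- by exists (x0 - x0), x0 => //; exists (- x0) => //; exists x0.
- have -> : difference_body K =
      [set p.1 - p.2 | p in K `*` K].
    apply/seteqP; split=> [_ [x Kx [_ [y Ky <-]] <-]|_ [[x y] [/= Kx Ky] <-]].
      by exists (x, y).
    by exists x => //; exists (- y) => //; exists y.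
  apply: continuous_compact; last exact: compact_setX.
  by apply: continuous_subspaceT; exact: sub_continuous.
- apply/convex_setP => _ _ t [x Kx [_ [y Ky <-] <-]]
    [x' Kx' [_ [y' Ky' <-] <-]] t01.
  exists (t *: x + (1 - t) *: x'); first exact: xK.
  exists (- (t *: y + (1 - t) *: y')).
    by exists (t *: y + (1 - t) *: y') => //; exact: xK.
  by rewrite !scalerDr !scalerN opprD addrACA.
Qed.

Lemma set_scaleE n a (K : set 'cV[R]_n) :
  set_scale a K = [set a%:M *m x | x in K].
Proof.
by apply/seteqP; split=> _ [x Kx <-]; exists x => //; rewrite mul_scalar_mx.
Qed.

(** The normal is [x - y0], where [y0] is the point of [K] nearest to [x] for the Euclidean
    distance; [d] is its square, since the norm on matrices is the sup norm. *)
Lemma separation n (K : set 'cV[R]_n) x : convex_bodies K -> ~ K x ->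
  exists2 w, w != 0 & forall y, K y -> lform w y < lform w x.
Proof.
move=> [K0 cK /convex_setP xK] nKx.
pose d (y : 'cV[R]_n) : R := \sum_i (y i 0 - x i 0) ^+ 2.
have cd : continuous d.
  apply: continuous_sum => i y.
  apply: (@continuous_comp _ _ _ (fun y : 'cV[R]_n => y i 0 - x i 0)
      (fun t : R => t ^+ 2)).
    apply: (@continuousB _ _ _ (fun y : 'cV[R]_n => y i 0) (cst (x i 0))).
      exact: coord_continuous.
    exact: cst_continuous.
  exact: exprn_continuous.
have [y0 Ky0 y0min] := compact_min K0 cK cd.
pose w : 'rV[R]_n := (x - y0)^T.
have wx : 0 < lform w (x - y0).
  rewrite lformE lt0r sumr_ge0 => [|i _]; last by rewrite mxE -expr2 sqr_ge0.
  rewrite andbT; apply/negP => /eqP/psumr_eq0P z; apply: nKx.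
  suff -> : x = y0 by [].
  apply/colP => i; apply/eqP; rewrite -subr_eq0 -sqrf_eq0 expr2.
  have := z (fun j _ => _) i isT; rewrite !mxE => ->// j.
  by rewrite !mxE -expr2 sqr_ge0.
exists w.
  by apply/negP => /eqP w0; move: wx; rewrite w0 /lform mul0mx mxE ltxx.
move=> y Ky; rewrite ltNge; apply/negP => wyx.
pose A := lform w (y - y0).
have A0 : 0 < A by move: wyx wx; rewrite /A !lformD !lformN; lra.
pose B := \sum_i (y i 0 - y0 i 0) ^+ 2.
have B0 : 0 <= B by apply: sumr_ge0 => i _; exact: sqr_ge0.
(* Minimality of [d] at [y0] along the segment from [y0] to [y], after expanding the squares. *)
have key t : 0 <= t <= 1 -> 2 * t * A <= t ^+ 2 * B.
  move=> t01; have H := y0min _ (xK y y0 t Ky Ky0 t01).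
  rewrite -subr_ge0 /d -sumrB in H; move: H.
  rewrite (eq_bigr (fun i => t ^+ 2 * (y i 0 - y0 i 0) ^+ 2 -
     2 * t * (w 0 i * (y - y0) i 0))); last by move=> i _; rewrite !mxE; ring.
  by rewrite sumrB -!mulr_sumr -lformE subr_ge0.
(* With this [t] one has [t * B = A - t * A], and [key] becomes [2 * A <= A - t * A], which is
   impossible. *)
pose t := A / (A + B).
have AB : 0 < A + B by lra.
have t0 : 0 < t by rewrite divr_gt0.
have t1 : t <= 1 by rewrite ler_pdivrMr// mul1r lerDl.
have := key t; rewrite (ltW t0) t1 => /(_ isT).
have tAB : t * (A + B) = A by rewrite divfK// gt_eqF.
have tB : t * B = A - t * A by lra.
have -> : t ^+ 2 * B = t * (A - t * A) by rewrite expr2 -mulrA tB.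
rewrite [2 * t]mulrC -mulrA ler_pM2l//.
have : 0 < t * A by rewrite mulr_gt0.
lra.
Qed.

End ConvexBodies.

(** * Volume *)

Section Volume.
Variable R : realType.

(* Slicing along the last coordinate and integrating over it; the weights [P]
   select the boxes that meet the slice. *)
Lemma cube_cover_sum n (s : R) (a b : nat -> nat -> R) (P : pred nat) :
  0 <= s -> (forall k i, a k i <= b k i) ->
  (forall x : nat -> R, (forall i, (i < n)%N -> 0 <= x i <= s) ->
    exists2 k, P k & forall i, (i < n)%N -> a k i <= x i <= b k i) ->
  ((s ^+ n)%:E <=
     \sum_(0 <= k <oo) ((P k)%:R * \prod_(i < n) (b k i - a k i))%:E)%E.
Proof.
move=> s0 ab.
have V0 m k : 0 <= \prod_(i < m) (b k i - a k i).
  by apply: prodr_ge0 => i _; rewrite subr_ge0.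
have W0 (Q : pred nat) m k : 0 <= (Q k)%:R * \prod_(i < m) (b k i - a k i).
  by rewrite mulr_ge0.
elim: n P => [|n IH] P cov.
  (* In dimension 0 the cube is a point of volume 1 and the products are empty, so a single selected
     index suffices. *)
  have [|k Pk _] := cov (fun=> 0); first by [].
  apply: le_trans (nneseries_lim_ge k.+1 _); last first.
    by move=> j _ _; rewrite lee_fin.
  rewrite sumEFin lee_fin big_nat_recr//= Pk big_ord0 mulr1 lerDr.
  by apply: sumr_ge0 => j _; rewrite W0.
pose I k : set R := `[a k n, b k n]%classic.
pose D : set R := `[0, s]%classic.
pose f k t : \bar R :=
  (((P k)%:R * \prod_(i < n) (b k i - a k i)) * \1_(I k) t)%:E.
have mI k : measurable (I k) by exact: measurable_itv.
have mD : measurable D by exact: measurable_itv.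
have mf k : measurable_fun D (f k).
  apply/measurable_EFinP; apply: measurable_funM; first exact: measurable_cst.
  by apply: measurable_indic.
have f0 k t : D t -> (0 <= f k t)%E by move=> _; rewrite lee_fin mulr_ge0.
(* At height [t], the selected boxes whose last side contains [t] cover the slice of the cube; the
   induction hypothesis applies to them. *)
have slice t : D t -> ((s ^+ n)%:E <= \sum_(0 <= k <oo) f k t)%E.
  rewrite /D /= in_itv /= => tD.
  apply: le_trans (IH (fun k => P k && (t \in I k)) _) _.
    move=> x xs; have [|k Pk xk] := cov (fun i => if (i < n)%N then x i else t).
      by move=> i _; case: ifP => // /xs.
    exists k => [|i ni]; last by have := xk i (ltnW ni); rewrite ni.
    rewrite Pk inE /I /= in_itv /=; have := xk n (ltnSn n); by rewrite ltnn.
  apply: lee_nneseries => k _.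
    by move=> _; rewrite lee_fin mulr_ge0.
  rewrite lee_fin indicE.
  by rewrite -mulnb natrM mulrAC.
have integ : (\int[lebesgue_measure]_(t in D) (s ^+ n)%:E = (s ^+ n.+1)%:E)%E.
  rewrite integral_cst//= lebesgue_measure_itv /= lte_fin.
  case: ltP => [_|s0']; first by rewrite oppr0 adde0 -EFinM -exprSr.
  have -> : s = 0 by apply/eqP; rewrite eq_le s0 andbT.
  by rewrite mule0 expr0n.
rewrite -integ; apply: (@le_trans _ _ (\int[lebesgue_measure]_(t in D)
    (\sum_(0 <= k <oo) f k t)%E)%E).
  apply: ge0_le_integral => //.
  - by move=> t _; rewrite lee_fin exprn_ge0.
  - apply: (@ge0_emeasurable_sum _ _ _ D f xpredT) => [k t Dt _|k _].
      exact: f0.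
    exact: mf.
rewrite integral_nneseries//; apply: lee_nneseries => k _.
  by move=> _; apply: integral_ge0 => t Dt; exact: f0.
rewrite /f; under eq_integral do rewrite EFinM.
rewrite ge0_integralZl_EFin//; last first.
  by apply/measurable_EFinP; apply: measurable_indic; exact: mI.
rewrite integral_indic; [|exact: mD|exact: mI].
rewrite big_ord_recr /= mulrA [in leRHS]EFinM.
apply: lee_wpmul2l; first by rewrite lee_fin; exact: W0.
apply: (@le_trans _ _ (lebesgue_measure (I k))).
  apply: (@le_measure _ _ _ lebesgue_measure); rewrite ?inE.
  - by apply: measurableI; [exact: mI | exact: mD].
  - exact: mI.
  - exact: subIsetl.
rewrite /I lebesgue_measure_itv /= lte_fin; case: ltP => // _.
by rewrite lee_fin subr_ge0.
Qed.

Lemma Vol_ge_cube n (s : R) (A : set 'cV[R]_n) : 0 <= s ->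
  (forall x : 'cV[R]_n, (forall i, 0 <= x i 0 <= s) -> A x) ->
  ((s ^+ n)%:E <= Vol A)%E.
Proof.
move=> s0 sA; apply: le_ereal_inf_tmp => _ [a [b [ab Ac ->]]].
(* Columns are extended by 0 to sequences, the form in which [cube_cover_sum] can do induction on
   the dimension. *)
pose ext (c : nat -> 'cV[R]_n) k i :=
  if insub i is Some j then c k (j : 'I_n) 0 else 0.
have extE c k (i : 'I_n) : ext c k i = c k i 0 by rewrite /ext valK.
have := @cube_cover_sum n s (ext a) (ext b) xpredT s0.
under eq_eseriesr do under eq_bigr do rewrite !extE.
under eq_eseriesr do rewrite mul1r.
apply.
  by move=> k i; rewrite /ext; case: insubP => // j _ _; exact: ab.
move=> x xs; have [|k _ xk] := Ac (\col_i x i).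
  by apply: sA => i; rewrite mxE xs.
exists k => // i ni; have := xk (Ordinal ni).
by rewrite mxE -!extE.
Qed.

(** A cover of [B] by boxes yields a cover of [A]: all translates of these boxes by the [z j]. The
    index [k] codes the box [k %/ N.+1] and the translation [k %% N.+1]. *)
Lemma Vol_le_translates n N (z : 'I_N.+1 -> 'cV[R]_n) (A B : set 'cV[R]_n) :
  (forall x, A x -> exists j, B (x - z j)) ->
  (Vol A <= N.+1%:R%:E * Vol B)%E.
Proof.
move=> AB; rewrite /Vol -ereal_inf_pZl ?ltr0n//.
apply: le_ereal_inf_tmp => _ [_ [a [b [ab Bc ->]]] <-].
pose j k : 'I_N.+1 := inord (k %% N.+1).
pose sh (c : nat -> 'cV[R]_n) k := c (k %/ N.+1)%N + z (j k).
pose v k := \prod_(i < n) (b k i 0 - a k i 0).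
have v0 k : 0 <= v k by apply: prodr_ge0 => i _; rewrite subr_ge0.
have vE k : \prod_(i < n) (sh b k i 0 - sh a k i 0) = v (k %/ N.+1)%N.
  by apply: eq_bigr => i _; rewrite !mxE; ring.
apply: (@le_trans _ _ (\sum_(0 <= k <oo) (v (k %/ N.+1)%N)%:E)%E).
  apply: ereal_inf_lbound; exists (sh a), (sh b); split.
  - by move=> k i; rewrite !mxE lerD2r.
  - move=> x /AB[l /Bc[k _ xk]]; exists (k * N.+1 + l)%N => // i.
    have ->: sh a (k * N.+1 + l)%N = a k + z l.
      rewrite /sh /j divnMDl// modnMDl divn_small// modn_small//.
      by rewrite addn0 inord_val.
    have ->: sh b (k * N.+1 + l)%N = b k + z l.
      rewrite /sh /j divnMDl// modnMDl divn_small// modn_small//.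
      by rewrite addn0 inord_val.
    by have := xk i; rewrite !mxE lerBrDr lerBlDr.
  - by apply: eq_eseriesr => k _; rewrite vE.
(* The first [m * N.+1] indices run through the first [m] boxes, each [N.+1] times. *)
have sumv m : \sum_(0 <= k < m * N.+1) v (k %/ N.+1)%N =
    N.+1%:R * \sum_(0 <= k < m) v k.
  elim: m => [|m IH]; first by rewrite !big_geq// mulr0.
  rewrite mulSn addnC (big_cat_nat (n := (m * N.+1)%N)) ?leq_addr//= IH.
  rewrite big_nat_recr//= mulrDr; congr (_ + _).
  rewrite -[X in \sum_(X <= _ < _) _]add0n big_addn addKn big_mkord.
  rewrite (eq_bigr (fun=> v m)) ?sumr_const ?card_ord ?mulr_natl// => i _.
  by rewrite addnC divnMDl// divn_small// addn0.
apply: lime_le; first by apply: is_cvg_nneseries => k _ _; rewrite lee_fin.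
apply: nearW => m.
apply: (@le_trans _ _ (\sum_(0 <= k < m * N.+1) (v (k %/ N.+1)%N)%:E)%E).
  by apply: lee_sum_nneg_natr => [k _ _|]; rewrite ?lee_fin// leq_pmulr.
rewrite sumEFin sumv EFinM; apply: lee_wpmul2l; first by rewrite lee_fin.
by rewrite -sumEFin; apply: nneseries_lim_ge => k _ _; rewrite lee_fin.
Qed.

(** The box, repeated at every index, is a cover of itself with total volume 0. *)
Lemma Vol_degenerate_box n (a b : 'cV[R]_n) (i : 'I_n) :
  (forall j, a j 0 <= b j 0) -> a i 0 = b i 0 -> (Vol (closed_box a b) <= 0)%E.
Proof.
move=> ab abi; apply: ereal_inf_lbound.
exists (fun=> a), (fun=> b); split=> //; first by move=> x xab; exists 0%N.
rewrite eseries0// => k _ _.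
by rewrite (bigD1 i)//= abi subrr mul0r.
Qed.

End Volume.

(** * Bounded coordinates and the Rogers-Shephard type inequality *)

Section SpanningPoints.
Variable R : realType.

(* Gaussian elimination with complete pivoting inside [K]: the pivot maximizes
   the coordinate to be eliminated, so that the elimination coefficients are
   bounded by 1. *)
Lemma spanning_points_aux n m : (m <= n)%N ->
  exists2 c : R, 0 <= c & forall K : set 'cV[R]_n, K !=set0 -> compact K ->
    (forall x (i : 'I_n), K x -> (m <= i)%N -> x i 0 = 0) ->
    exists2 u : nat -> 'cV[R]_n, (forall k, K (u k)) &
      forall x, K x -> exists2 s : nat -> R, (forall k, `|s k| <= c) &
        x = \sum_(k < m) s k *: u k.
Proof.
elim: m => [_|m IH mn].
  exists 0 => // K [x0 Kx0] _ K0; exists (fun=> x0) => // x Kx.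
  exists (fun=> 0) => [k|]; first by rewrite normr0.
  by rewrite big_ord0; apply/colP => i; rewrite mxE (K0 x).
have [c c0 {}IH] := IH (ltnW mn).
(* The new coefficient is at most [1 + m * c]; the factor [m.+1] lets the constant dominate [c] as
   well, hence the old coefficients. *)
exists (1 + m.+1%:R * c) => [|K K0 cK Km]; first by rewrite addr_ge0 ?mulr_ge0.
have cc : c <= 1 + m.+1%:R * c.
  have : 0 <= m%:R * c by rewrite mulr_ge0.
  by rewrite -natr1; lra.
pose j := Ordinal mn.
have cj : continuous (fun x : 'cV[R]_n => `|x j 0|).
  move=> x; apply: (@continuous_comp _ _ _ (fun x : 'cV[R]_n => x j 0)
    (fun t : R => `|t|)); first exact: coord_continuous.
  exact: norm_continuous.
have [u Ku umax] := compact_max K0 cK cj.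
have [uj0|uj0] := eqVneq (u j 0) 0.
  have [|v Kv vK] := IH K K0 cK.
    move=> x i Kx; rewrite leq_eqVlt => /predU1P[mi|]; last exact: Km.
    have -> : i = j by apply: val_inj.
    by apply/eqP; rewrite -normr_le0 -(normr0 R) -uj0 umax.
  exists v => // x /vK[s sc ->]; exists (fun k => if (k < m)%N then s k else 0).
    move=> k; case: ifP => _; first exact: le_trans cc.
    by rewrite normr0 (le_trans c0).
  rewrite big_ord_recr /= ltnn scale0r addr0; apply: eq_bigr => i _.
  by rewrite ltn_ord.
(* [P] is the projection along [u] that annihilates coordinate [j]. *)
pose P : 'M[R]_n := 1%:M - (u j 0)^-1 *: (u *m delta_mx 0 j).
have PE x : P *m x = x - (x j 0 / u j 0) *: u.
  rewrite mulmxBl mul1mx -scalemxAl -mulmxA -rowE.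
  have -> : row j x = (x j 0)%:M by apply/matrixP => a b; rewrite !ord1 !mxE.
  by rewrite mul_mx_scalar scalerA mulrC.
have [|||v Kv vK] := IH [set P *m x | x in K].
- by exists (P *m u); exists u.
- apply: continuous_compact => //; apply: continuous_subspaceT.
  exact: mulmx_continuous.
- move=> _ i [x Kx <-]; rewrite PE !mxE leq_eqVlt => /predU1P[mi|mi].
    have -> : i = j by apply: val_inj.
    by rewrite divfK// subrr.
  by rewrite (Km x i)// (Km u i)// mulr0 subrr.
have [v' Kv' Pv'] : exists2 v' : nat -> 'cV[R]_n,
    (forall k, K (v' k)) & forall k, P *m v' k = v k.
  have /choice[f fP] : forall k, exists y, K y /\ P *m y = v k.
    by move=> k; have [y] := Kv k; exists y.
  by exists f => k; have [] := fP k.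
exists (fun k => if (k < m)%N then v' k else u) => [k|x Kx]; first by case: ifP.
have [|s sc] := vK (P *m x); first by exists x.
rewrite PE; under eq_bigr do rewrite -Pv' PE scalerBr.
rewrite sumrB => xE.
(* Lifting the expansion of [P *m x] from the [v k] to the [v' k] changes it by multiples of [u];
   [t] collects them. Each quotient by [u j 0] is at most 1 in absolute value by the choice of the
   pivot. *)
pose t := x j 0 / u j 0 - \sum_(k < m) s k * (v' k j 0 / u j 0).
exists (fun k => if (k < m)%N then s k else t) => [k|].
  case: ifP => _; first exact: le_trans cc.
  have q1 y : K y -> `|y j 0 / u j 0| <= 1.
    by move=> Ky; rewrite normrM normfV ler_pdivrMr ?normr_gt0// mul1r umax.
  rewrite /t (le_trans (ler_normB _ _))// lerD ?q1//.
  apply: (le_trans (ler_norm_sum _ _ _)).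
  apply: (@le_trans _ _ (\sum_(i < m) c)).
    apply: ler_sum => i _; rewrite normrM -[leRHS]mulr1.
    by apply: ler_pM => //; exact: q1.
  by rewrite sumr_const card_ord -[leLHS]mulr_natl ler_wpM2r// ler_nat.
rewrite big_ord_recr /= ltnn.
under eq_bigr do rewrite ltn_ord.
have -> : x = \sum_(i < m) s i *: v' i
    - \sum_(i < m) s i *: ((v' i j 0 / u j 0) *: u) + (x j 0 / u j 0) *: u.
  by rewrite -xE subrK.
rewrite -addrA; congr (_ + _); rewrite {}/t scalerBl addrC; congr (_ - _).
by rewrite scaler_suml; apply: eq_bigr => i _; rewrite scalerA.
Qed.

(** The bound [c] is chosen before [K]; this is what makes the Rogers-Shephard constant uniform. *)
Lemma spanning_points n :
  exists2 c : R, 0 <= c & forall K : set 'cV[R]_n, K !=set0 -> compact K ->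
    exists2 u : nat -> 'cV[R]_n, (forall k, K (u k)) &
      forall x, K x -> exists2 s : nat -> R, (forall k, `|s k| <= c) &
        x = \sum_(k < n) s k *: u k.
Proof.
have [c c0 cP] := spanning_points_aux (leqnn n).
exists c => // K K0 cK; apply: cP => // x i _.
by rewrite leqNgt ltn_ord.
Qed.

Lemma convex_mean n (K : set 'cV[R]_n) (y : nat -> 'cV[R]_n) m :
  convex_set K -> (forall k, K (y k)) ->
  K (\sum_(k < m.+1) m.+1%:R^-1 *: y k).
Proof.
move=> /convex_setP cK Ky; elim: m => [|m IH].
  by rewrite big_ord_recr big_ord0 /= add0r invr1 scale1r.
have m0 : m.+1%:R != 0 :> R by rewrite pnatr_eq0.
have m20 : m.+2%:R != 0 :> R by rewrite pnatr_eq0.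
have := cK _ _ (m.+1%:R / m.+2%:R) IH (Ky m.+1).
rewrite divr_ge0// ler_pdivrMr ?ltr0n// mul1r ler_nat leqnSn => /(_ isT).
rewrite [X in _ -> K X]big_ord_recr scaler_sumr /=.
have -> : 1 - m.+1%:R / m.+2%:R = m.+2%:R^-1 :> R.
  by rewrite -[X in X - _](divff m20) -mulrBl -natrB// subSnn mul1r.
by under eq_bigr do rewrite scalerA mulrAC divff// mul1r.
Qed.

Lemma symmetric_scale n (K : set 'cV[R]_n) x t :
  symmetric_convex_bodies K -> K x -> -1 <= t <= 1 -> K (t *: x).
Proof.
move=> [[_ _ /convex_setP cK] sK] Kx t1.
have KNx : K (- x) by rewrite sK; exists x.
have := cK _ _ ((1 + t) / 2) Kx KNx.
have -> : ((1 + t) / 2) *: x + (1 - (1 + t) / 2) *: - x = t *: x.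
  by rewrite scalerN -scalerBl; congr (_ *: _); field.
by apply; lra.
Qed.

(** Let the spanning points be the columns of [A]. If [A] is singular, a vector of its left kernel
    is the required form. Otherwise [K], being symmetric and convex, contains a cube [[0, e]^(n+1)]
    and has positive volume. *)
Lemma Vol0_hyperplane n (K : set 'cV[R]_n.+1) :
  symmetric_convex_bodies K -> (Vol K <= 0)%E ->
  exists2 w, w != 0 & forall x, K x -> lform w x = 0.
Proof.
move=> sK VK; have [[K0 cK xK] _] := sK.
have [c _ /(_ K K0 cK)[u Ku uK]] := spanning_points n.+1.
pose A : 'M[R]_n.+1 := \matrix_(i, k) u k i 0.
have AE t : A *m t = \sum_(k < n.+1) t k 0 *: u k.
  apply/colP => i; rewrite mxE summxE; apply: eq_bigr => k _.
  by rewrite !mxE mulrC.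
have [/det0P[w w0 wA]|dA] := boolP (\det A == 0).
  exists w => // x /uK[s _ ->].
  have -> : \sum_(k < n.+1) s k *: u k = A *m (\col_k s k).
    by rewrite AE; apply: eq_bigr => k _; rewrite mxE.
  by rewrite /lform mulmxA wA mul0mx mxE.
have Au : A \in unitmx by rewrite unitmxE unitfE.
(* [S] bounds every absolute row sum of [invmx A], and the summand 1 makes it positive. With [e] as
   below, the coordinates [t] of a point of the cube with respect to the [u k] are at most
   [1 / (n+1)] in absolute value. *)
pose S : R := 1 + \sum_i \sum_j `|invmx A i j|.
have S0 : 0 < S.
  by rewrite ltr_pwDl// sumr_ge0// => i _; rewrite sumr_ge0.
pose e := (n.+1%:R * S)^-1.
have e0 : 0 < e by rewrite invr_gt0 mulr_gt0.
suff : ((e ^+ n.+1)%:E <= Vol K)%E.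
  move=> /le_trans/(_ VK); rewrite lee_fin leNgt => /negP; case.
  by rewrite exprn_gt0.
apply: Vol_ge_cube => [|x xe]; first exact: ltW.
pose t := invmx A *m x.
have te k : `|t k 0| <= n.+1%:R^-1.
  rewrite mxE (le_trans (ler_norm_sum _ _ _))//.
  apply: (@le_trans _ _ (\sum_j `|invmx A k j| * e)).
    apply: ler_sum => j _; rewrite normrM ler_wpM2l//.
    by have /andP[x0 x1] := xe j; rewrite ger0_norm.
  rewrite -mulr_suml /e invfM mulrCA -[leRHS]mulr1 ler_wpM2l ?invr_ge0//.
  rewrite ler_pdivrMr// mul1r /S [X in _ <= _ + X](bigD1 k)//= addrCA lerDl.
  by rewrite addr_ge0// sumr_ge0// => i _; rewrite sumr_ge0.
(* [x] is the mean of multiples of the [u k] by factors in [[-1, 1]]; [u 0] only fills the indices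
   beyond [n]. *)
have -> : x = \sum_(k < n.+1) n.+1%:R^-1 *:
    (if insub (k : nat) is Some j then (n.+1%:R * t j 0) *: u k else u 0%N).
  transitivity (A *m t); first by rewrite mulKVmx.
  by rewrite AE; apply: eq_bigr => k _; rewrite valK scalerA mulKf ?pnatr_eq0//.
apply: (@convex_mean _ _ (fun k => if insub k is Some j then
   (n.+1%:R * t (j : 'I_n.+1) 0) *: u k else u 0%N)) => // k.
case: insubP => // j _ _; apply: symmetric_scale => //.
rewrite -ler_norml normrM ger0_norm//.
by have := ler_wpM2l (ler0n R n.+1) (te j); rewrite divff ?pnatr_eq0.
Qed.

(** Expand a point of the scaled difference body in the [u k], multiply the coefficients by [n+1]
    and round them down. The integer parts select one of finitely many translations, and the
    fractional parts leave a mean of points of [K]. *)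
Lemma difference_body_rogers_shephard n (lambda : R) : (0 < n)%N ->
  exists2 C : R, 0 < C & forall K : set 'cV[R]_n, convex_bodies K ->
    (Vol (set_scale lambda (difference_body K)) <= C%:E * Vol K)%E.
Proof.
case: n => // n _; have [c c0 cP] := spanning_points n.+1.
(* Bound for the multiplied coefficients [n.+1 * (lambda * (s k - r k))]; adding [Q] makes them
   nonnegative, so that they can be truncated to numbers from 0 to [Q + Q]. *)
pose M := n.+1%:R * (`|lambda| * (c + c)).
have M0 : 0 <= M by rewrite !mulr_ge0// addr_ge0.
pose Q := (Num.truncn M).+1.
have MQ : M <= Q%:R by apply: ltW; exact: truncnS_gt.
pose T := {ffun 'I_n.+1 -> 'I_(Q + Q).+1}.
have T0 : (0 < #|T|)%N by apply/card_gt0P; exists [ffun=> ord0].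
exists #|T|%:R => [|K [[v0 Kv0] cK xK]]; first by rewrite ltr0n.
have [||u Ku uK] := cP [set x - v0 | x in K].
- by exists (v0 - v0), v0.
- apply: continuous_compact => //; apply: continuous_subspaceT => x.
  apply: (@continuousB _ _ _ id (cst v0)); first exact: cvg_id.
  exact: cst_continuous.
pose z (f : T) : 'cV[R]_n.+1 :=
  \sum_k (((f k)%:R - Q%:R) / n.+1%:R) *: u k - v0.
have t0 : T := [ffun=> ord0].
rewrite -(prednK T0).
apply: (Vol_le_translates (z := fun i => z (nth t0 (enum T) i))).
move=> _ [_ [x Kx [_ [y Ky <-] <-]] <-].
have [|s sc xE] := uK (x - v0); first by exists x.
have [|r rc yE] := uK (y - v0); first by exists y.
pose q k := n.+1%:R * (lambda * (s k - r k)) + Q%:R.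
have qQ k : 0 <= q k <= (Q + Q)%:R.
  have : `|n.+1%:R * (lambda * (s k - r k))| <= M.
    rewrite normrM ger0_norm// ler_wpM2l// normrM ler_wpM2l//.
    by rewrite (le_trans (ler_normB _ _))// lerD.
  rewrite ler_norml natrD /q; lra.
pose f : T := [ffun k : 'I_n.+1 => inord (Num.truncn (q k))].
have fE k : (f k)%:R = (Num.truncn (q k))%:R :> R.
  rewrite ffunE inordK// ltnS -(ler_nat R).
  by have /andP[q0] := qQ k; apply: le_trans; rewrite truncn_le.
have ft : (index f (enum T) < #|T|.-1.+1)%N.
  by rewrite prednK// cardE index_mem mem_enum.
exists (Ordinal ft); rewrite /= nth_index ?mem_enum// /z.
pose g k := q k - (Num.truncn (q k))%:R.
have g01 k : 0 <= g k <= 1.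
  have /andP[q0 _] := qQ k; have := truncn_itv q0.
  by rewrite /g -natr1; lra.
(* The term [- v0] in [z] supplies the summand [v0] that turns [g k *: u k] into a point of the
   segment from [v0] to [u k + v0], which lies in [K]. *)
have -> : lambda *: (x + - y) -
      (\sum_k (((f k)%:R - Q%:R) / n.+1%:R) *: u k - v0) =
    \sum_(k < n.+1) n.+1%:R^-1 *: (g k *: (u k + v0) + (1 - g k) *: v0).
  have -> : x - y = (x - v0) - (y - v0) by rewrite opprB addrA subrK.
  rewrite xE yE opprB addrCA -sumrB scaler_sumr -sumrB.
  have {1}-> : v0 = \sum_(k < n.+1) n.+1%:R^-1 *: v0.
    rewrite sumr_const card_ord -scaler_nat scalerA.
    by rewrite divff ?scale1r ?pnatr_eq0.
  rewrite -big_split; apply: eq_bigr => k _ /=.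
  apply/colP => i; rewrite !mxE fE /g /q; field.
  by rewrite ?nat1r ?natr1 pnatr_eq0.
apply: (@convex_mean _ _ (fun k => g k *: (u k + v0) + (1 - g k) *: v0)) => //.
move=> k.
move/convex_setP : xK => xK; apply: xK => //.
by have [y' Ky' <-] := Ku k; rewrite subrK.
Qed.

End SpanningPoints.

(** * Hausdorff distance and covariance under singular matrices *)

Section Hausdorff.
Variable R : realType.

Lemma euclidean_norm_le n (x : 'cV[R]_n) r : 0 <= r ->
  (euclidean_norm x <= r) = (\sum_i x i 0 ^+ 2 <= r ^+ 2).
Proof.
move=> r0; rewrite -{1}(ger0_norm r0) -sqrtr_sqr.
by rewrite ler_sqrt// exprn_ge0.
Qed.

Lemma euclidean_norm_le_mx n (x : 'cV[R]_n) :
  euclidean_norm x <= n%:R * `|x|.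
Proof.
rewrite euclidean_norm_le ?mulr_ge0// exprMn.
apply: (@le_trans _ _ (\sum_(i < n) `|x| ^+ 2)).
  apply: ler_sum => i _; rewrite -real_normK ?num_real//.
  by rewrite lerXn2r ?nnegrE// le_mx_norm.
rewrite sumr_const card_ord -[leLHS]mulr_natl ler_wpM2r ?exprn_ge0//.
by rewrite -natrX ler_nat; case: n {x} => // n; rewrite expnS leq_pmulr.
Qed.

Lemma le_euclidean_norm n (x : 'cV[R]_n) : `|x| <= euclidean_norm x.
Proof.
apply: mx_norm_le => [|i j]; first exact: sqrtr_ge0.
rewrite ord1 -sqrtr_sqr ler_sqrt ?sumr_ge0// => [|k _]; last exact: sqr_ge0.
by rewrite (bigD1 i)//= lerDl sumr_ge0// => k _; exact: sqr_ge0.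
Qed.

Lemma euclidean_normN n (x : 'cV[R]_n) :
  euclidean_norm (- x) = euclidean_norm x.
Proof.
by congr Num.sqrt; apply: eq_bigr => i _; rewrite !mxE sqrrN.
Qed.

(** Since both vectors have the same bound, [|x - y|^2 <= 2 |x|^2 + 2 |y|^2] replaces the triangle
    inequality. *)
Lemma euclidean_norm_scaleB n (x y : 'cV[R]_n) t r : 0 <= t -> 0 <= r ->
  euclidean_norm x <= r -> euclidean_norm y <= r ->
  euclidean_norm (t *: (x - y)) <= t * (2 * r).
Proof.
move=> t0 r0; rewrite !euclidean_norm_le ?mulr_ge0// => xr yr.
rewrite exprMn.
apply: (@le_trans _ _
    (\sum_i (t ^+ 2 * (2 * x i 0 ^+ 2 + 2 * y i 0 ^+ 2)))).
  apply: ler_sum => i _; rewrite !mxE exprMn ler_wpM2l ?sqr_ge0//.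
  by have := sqr_ge0 (x i 0 + y i 0); nra.
rewrite -mulr_sumr ler_wpM2l ?sqr_ge0// big_split /= -!mulr_sumr.
by rewrite exprMn; lra.
Qed.

Lemma in_parallel_body n (K : set 'cV[R]_n) r x :
  minkowski_sum K (euclidean_ball r) x <->
  exists2 y, K y & euclidean_norm (x - y) <= r.
Proof.
split=> [[y Ky [b br <-]]|[y Ky xy]].
  by exists y => //; rewrite addrAC subrr add0r.
by exists y => //; exists (x - y) => //; rewrite addrC subrK.
Qed.

Lemma hausdorff_dist_lt n (K L : set 'cV[R]_n) r e : 0 <= r < e ->
  (forall x, K x -> exists2 y, L y & euclidean_norm (x - y) <= r) ->
  (forall x, L x -> exists2 y, K y & euclidean_norm (x - y) <= r) ->
  hausdorff_dist K L < e.
Proof.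
move=> /andP[r0 re] KL LK; apply: le_lt_trans re.
apply: ge_inf; first by exists 0 => s [].
by split=> // x => [/KL|/LK] /in_parallel_body.
Qed.

(* Compactness makes the set whose infimum is taken nonempty; otherwise the
   infimum would be the junk value 0. *)
Lemma hausdorff_dist_ltP n (K L : set 'cV[R]_n) e :
  convex_bodies K -> convex_bodies L -> hausdorff_dist K L < e ->
  exists r, [/\ 0 <= r < e,
    forall x, K x -> exists2 y, L y & euclidean_norm (x - y) <= r &
    forall x, L x -> exists2 y, K y & euclidean_norm (x - y) <= r].
Proof.
move=> [[x0 Kx0] cK _] [[y0 Ly0] cL _] KLe.
pose D := [set r : R | [/\ 0 <= r, K `<=` minkowski_sum L (euclidean_ball r) &
    L `<=` minkowski_sum K (euclidean_ball r)]].
have [M M0 KM] := compact_bound cK; have [M' M'0 LM] := compact_bound cL.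
have bnd x y : K x -> L y -> euclidean_norm (x - y) <= n%:R * (M + M').
  move=> Kx Ly; rewrite (le_trans (euclidean_norm_le_mx _))// ler_wpM2l//.
  by rewrite (le_trans (ler_normB _ _))// lerD ?KM ?LM.
have iD : has_inf D.
  split; last by exists 0 => s [].
  exists (n%:R * (M + M')); split; first by rewrite mulr_ge0// addr_ge0 ?ltW.
    by move=> x Kx; apply/in_parallel_body; exists y0 => //; exact: bnd.
  move=> y Ly; apply/in_parallel_body; exists x0 => //.
  by rewrite -opprB euclidean_normN bnd.
have [|r [r0 KL LK] re] := @inf_adherent _ _ (e - inf D) _ iD.
  by rewrite subr_gt0.
exists r; split; first by rewrite r0 -(subrK (inf D) e) addrC.
  by move=> x /KL /in_parallel_body.
by move=> x /LK /in_parallel_body.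
Qed.

(** It suffices that [e] is not an eigenvalue. The candidates [d / (k+2)] are distinct, lie strictly
    between 0 and [d], and are too many to be all roots of the characteristic polynomial. *)
Lemma unit_perturbation n (g : 'M[R]_n) d : 0 < d ->
  exists2 e, 0 < e < d & g - e%:M \in unitmx.
Proof.
move=> d0; pose p := char_poly g.
have p0 : p != 0 by apply: monic_neq0; exact: char_poly_monic.
pose rs := [seq d / k.+2%:R | k <- iota 0 (size p)].
have urs : uniq rs.
  rewrite map_inj_uniq ?iota_uniq// => k l /(mulfI (lt0r_neq0 d0))/invr_inj.
  by move=> /eqP; rewrite eqr_nat => /eqP[].
have [/(max_poly_roots p0)/(_ urs)|/allPn[_ /mapP[k _ ->] nr]] :=
    boolP (all (root p) rs); first by rewrite size_map size_iota ltnn.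
exists (d / k.+2%:R); last first.
  move: nr; rewrite -eigenvalue_root_char /eigenvalue negbK /eigenspace.
  by rewrite kermx_eq0 row_free_unit.
by rewrite divr_gt0//= ltr_pdivrMr// ltr_pMr// ltr1n.
Qed.

(** For small [t] with [g - t%:M] invertible, covariance holds for [g - t%:M], and continuity brings
    both sides close to those for [g]. Both sides for [g] are closed, so they agree. *)
Lemma covariant_singular n (F : set 'cV[R]_n -> set 'cV[R]_n) :
  (forall K, convex_bodies K -> convex_bodies (F K)) ->
  hausdorff_continuous F -> GL_covariant F ->
  forall K, convex_bodies K -> forall g : 'M[R]_n,
    F [set g *m x | x in K] = [set g *m x | x in F K].
Proof.
move=> Fb Fc Fg K bK g.
have bgK := convex_body_image g bK.
have [_ cK _] := bK; have [M M0 KM] := compact_bound cK.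
have [_ cFK _] := Fb K bK; have [M' M'0 FKM] := compact_bound cFK.
have approx e : 0 < e -> exists t r, [/\ `|t| * M' < e, r < e,
    forall x, F [set g *m x | x in K] x ->
      exists2 z, F K z & `|x - (g - t%:M) *m z| <= r &
    forall z, F K z -> exists2 x, F [set g *m x | x in K] x &
      `|(g - t%:M) *m z - x| <= r].
  move=> e0; have [d d0 dP] := Fc _ bgK e e0.
  (* The first bound puts the image of [K] under [g - t%:M] within [d] of its image under [g], the
     [+ 1] keeping the denominator positive for [n = 0]; the second gives [t * M' < e]. *)
  have [|t /andP[t0 tlt] ut] := @unit_perturbation _ g
      (Num.min (d / (n%:R * M + 1)) (e / M')).
    by rewrite lt_min !divr_gt0// ltr_wpDl// mulr_ge0// ltW.
  move: tlt; rewrite lt_min ltr_pdivlMr; last first.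
    by rewrite ltr_wpDl// mulr_ge0// ltW.
  rewrite ltr_pdivlMr// => /andP[td te].
  have bgt := convex_body_image (g - t%:M) bK.
  have tx x : K x -> euclidean_norm (t *: x) <= t * (n%:R * M).
    move=> Kx; rewrite (le_trans (euclidean_norm_le_mx _))// normrZ gtr0_norm//.
    by rewrite mulrCA ler_wpM2l ?(ltW t0)// ler_wpM2l// KM.
  have tlt : 0 <= t * (n%:R * M) < d.
    rewrite !mulr_ge0 ?(ltW t0) ?(ltW M0)//=; apply: le_lt_trans td.
    by rewrite ler_wpM2l ?(ltW t0)// lerDl.
  have gtx x : (g - t%:M) *m x = g *m x - t *: x.
    by rewrite mulmxBl mul_scalar_mx.
  have gtd : hausdorff_dist [set g *m x | x in K]
      [set (g - t%:M) *m x | x in K] < d.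
    apply: (hausdorff_dist_lt tlt) => _ [x Kx <-].
      exists ((g - t%:M) *m x); first by exists x.
      by rewrite gtx opprB addrC subrK tx.
    exists (g *m x); first by exists x.
    by rewrite gtx addrAC subrr add0r euclidean_normN tx.
  have := dP _ bgt gtd; rewrite (Fg _ bK _ ut).
  move=> /(hausdorff_dist_ltP (Fb _ bgK) (convex_body_image _ (Fb _ bK))).
  move=> [r [/andP[r0 re] h1 h2]]; exists t, r; split=> //.
  - by rewrite gtr0_norm.
  - move=> x /h1[_ [z Fz <-] xz]; exists z => //.
    by rewrite (le_trans (le_euclidean_norm _)).
  - move=> z Fz; have [|x Fx zx] := h2 ((g - t%:M) *m z); first by exists z.
    by exists x => //; rewrite (le_trans (le_euclidean_norm _)).
have [_ /compact_closed_mx clF _] := Fb _ bgK.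
have [_ /compact_closed_mx clgF _] := convex_body_image g (Fb _ bK).
apply/seteqP; split=> x.
  move=> Fx; apply: closed_approx => // e e0.
  have [|t [r [te re h1 _]]] := approx (e / 2); first by rewrite divr_gt0.
  have [z Fz xz] := h1 _ Fx; exists (g *m z); first by exists z.
  have -> : x - g *m z = (x - (g - t%:M) *m z) - t *: z.
    by rewrite mulmxBl mul_scalar_mx; apply/colP => i; rewrite !mxE; ring.
  have : `|t *: z| <= `|t| * M' by rewrite normrZ ler_wpM2l// FKM.
  by have := ler_normB (x - (g - t%:M) *m z) (t *: z); lra.
move=> [z Fz <-]; apply: closed_approx => // e e0.
have [|t [r [te re _ h2]]] := approx (e / 2); first by rewrite divr_gt0.
have [x' Fx' zx] := h2 _ Fz; exists x' => //.
have -> : g *m z - x' = ((g - t%:M) *m z - x') + t *: z.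
  by rewrite mulmxBl mul_scalar_mx addrAC subrK.
have : `|t *: z| <= `|t| * M' by rewrite normrZ ler_wpM2l// FKM.
by have := ler_normD ((g - t%:M) *m z - x') (t *: z); lra.
Qed.

End Hausdorff.

(** * Support functions and the characterization *)

Section SupportFunction.
Variables (R : realType) (n : nat).
Implicit Types (K L : set 'cV[R]_n) (v w : 'rV[R]_n).

Definition support L w : R := sup [set lform w x | x in L].

Lemma support_max L w x : L x -> (forall y, L y -> lform w y <= lform w x) ->
  support L w = lform w x.
Proof.
move=> Lx xmax; apply/eqP; rewrite eq_le; apply/andP; split.
  by apply: ge_sup => [|_ [y Ly <-]]; [exists (lform w x), x | exact: xmax].
apply: ub_le_sup; last by exists x.
by exists (lform w x) => _ [y Ly <-]; exact: xmax.
Qed.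

Lemma support_attained L w : convex_bodies L ->
  exists x, [/\ L x, support L w = lform w x &
    forall y, L y -> lform w y <= lform w x].
Proof.
move=> [L0 cL _].
have [x Lx xmax] := compact_max L0 cL (@lform_continuous R n w).
by exists x; split=> //; exact: support_max.
Qed.

Lemma support_le L w c : convex_bodies L ->
  (forall x, L x -> lform w x <= c) -> support L w <= c.
Proof. by move=> /(support_attained w)[x [Lx -> _]]; exact. Qed.

Lemma le_support L w x : convex_bodies L -> L x -> lform w x <= support L w.
Proof. by move=> /(support_attained w)[y [_ -> ymax]]; exact: ymax. Qed.

Lemma supportD L v w : convex_bodies L ->
  support L (v + w) <= support L v + support L w.
Proof.
move=> Lb; apply: support_le => // x Lx.
by rewrite lformDl lerD// le_support.
Qed.

Lemma supportZ L t w : symmetric_convex_bodies L ->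
  support L (t *: w) = `|t| * support L w.
Proof.
move=> [Lb sL]; have [x [Lx -> xmax]] := support_attained w Lb.
have LN y : L y -> L (- y) by move=> Ly; rewrite sL; exists y.
have [t0|t0] := leP 0 t.
  rewrite ger0_norm// -lformZl; apply: support_max => // y Ly.
  by rewrite !lformZl ler_wpM2l// xmax.
rewrite ltr0_norm// mulNr -mulrN -lformN -lformZl.
apply: support_max => [|y Ly]; first exact: LN.
by rewrite !lformZl ler_nM2l// lformN lerNl -lformN xmax//; exact: LN.
Qed.

Lemma support_ge0 L w : symmetric_convex_bodies L -> 0 <= support L w.
Proof.
move=> sL; have := supportD w (- w) sL.1.
rewrite -scaleN1r supportZ// normrN1 mul1r scaleN1r subrr.
by rewrite -(scale0r w) supportZ// normr0 mul0r; lra.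
Qed.

(** A point of one body outside the other would be separated from it by some [w], at which the
    support functions would differ. *)
Lemma eq_support K L : convex_bodies K -> convex_bodies L ->
  (forall w, support K w = support L w) -> K = L.
Proof.
move=> Kb Lb KL.
have sub A B : convex_bodies A -> convex_bodies B ->
    (forall w, support A w = support B w) -> A `<=` B.
  move=> Ab Bb AB x Ax; apply: contrapT => /(separation Bb)[w _ wx].
  have [y [By wy _]] := support_attained w Bb.
  by have := le_support w Ab Ax; rewrite AB wy leNgt wx.
by apply/seteqP; split; apply: sub.
Qed.

Lemma lform_range K w p q : convex_set K -> K p -> K q ->
  (forall x, K x -> lform w p <= lform w x <= lform w q) ->
  [set lform w x | x in K] = `[lform w p, lform w q]%classic.
Proof.
move=> /convex_setP cK Kp Kq pq; apply/seteqP; split=> [_ [x Kx <-]|y] /=.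
  by rewrite in_itv /= pq.
rewrite in_itv /= => /andP[py yq].
have [pq0|pq0] := eqVneq (lform w q - lform w p) 0.
  by exists p => //; lra.
have pq1 : 0 < lform w q - lform w p.
  by rewrite lt0r pq0 subr_ge0 (le_trans py yq).
pose t := (y - lform w p) / (lform w q - lform w p).
exists (t *: q + (1 - t) *: p); last first.
  by rewrite lformD !lformZ /t; field.
apply: cK => //; apply/andP; split.
  by apply: divr_ge0; [rewrite subr_ge0 | exact: ltW].
by rewrite ler_pdivrMr// mul1r lerB.
Qed.

Lemma body_lform_range K w : convex_bodies K -> exists p q, [/\ K p, K q &
  forall x, K x -> lform w p <= lform w x <= lform w q].
Proof.
move=> [K0 cK _].
have [p Kp pmin] := compact_min K0 cK (@lform_continuous R n w).
have [q Kq qmax] := compact_max K0 cK (@lform_continuous R n w).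
by exists p, q; split=> // x Kx; rewrite pmin// qmax.
Qed.

Lemma set_scale_difference_body_symmetric t K : convex_bodies K ->
  symmetric_convex_bodies (set_scale t (difference_body K)).
Proof.
move=> Kb; split.
  rewrite set_scaleE; apply: convex_body_image.
  exact: convex_body_difference.
apply/seteqP; split=> [_ [_ [x Kx [_ [y Ky <-] <-]] <-]|].
  exists (t *: (y - x)); last by rewrite -scalerN opprB.
  by exists (y - x) => //; exists y => //; exists (- x) => //; exists x.
move=> _ [_ [_ [x Kx [_ [y Ky <-] <-]] <-] <-].
exists (y - x); last by rewrite -scalerN opprB.
by exists y => //; exists (- x) => //; exists x.
Qed.

Lemma support_difference_body K w p q t : K p -> K q -> 0 <= t ->
  (forall x, K x -> lform w p <= lform w x <= lform w q) ->
  support (set_scale t (difference_body K)) w = t * (lform w q - lform w p).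
Proof.
move=> Kp Kq t0 pq; rewrite -lformN -lformD -lformZ; apply: support_max.
  by exists (q - p) => //; exists q => //; exists (- p) => //; exists p.
move=> _ [_ [x Kx [_ [y Ky <-] <-]] <-].
rewrite !lformZ ler_wpM2l// !lformD !lformN.
by have := pq x Kx; have := pq y Ky; lra.
Qed.

End SupportFunction.

(** * Reduction to a seminorm on the plane *)

Section Characterization.
Variables (R : realType) (n : nat).
Local Notation V := 'cV[R]_n.+2.
Variable F : set V -> set V.
Hypothesis Fb : forall K, convex_bodies K -> symmetric_convex_bodies (F K).
Hypothesis Fc : hausdorff_continuous F.
Hypothesis Fg : GL_covariant F.

Let Fcb K : convex_bodies K -> convex_bodies (F K).
Proof. by move=> /Fb[]. Qed.

(* The rank one map [x |-> lform w x *: e_0] sends [K] and [K'] to the same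
   segment. *)
Lemma support_eq_range K K' (w w' : 'rV[R]_n.+2) :
  convex_bodies K -> convex_bodies K' ->
  [set lform w x | x in K] = [set lform w' x | x in K'] ->
  support (F K) w = support (F K') w'.
Proof.
move=> Kb Kb' KK'; rewrite /support; congr sup.
pose e : V := delta_mx 0 0.
have im (L : set V) v :
    [set (e *m v) *m x | x in L] = [set t *: e | t in [set lform v x | x in L]].
  rewrite image_comp; apply: eq_imagel => x _ /=.
  by rewrite -mulmxA (mx11_scalar (v *m x)) mul_mx_scalar.
(* Covariance under the singular matrix [e *m v] applies; as [e] has entry 1 at 0, the entry 0 of
   the image of [x] is [lform v x]. *)
have lf (L : set V) v : convex_bodies L -> [set lform v x | x in F L] =
    [set y 0 0 | y in F [set t *: e | t in [set lform v x | x in L]]].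
  move=> Lb; rewrite -im (covariant_singular Fcb)// im !image_comp.
  by apply: eq_imagel => x _ /=; rewrite !mxE mulr1.
by rewrite !lf// KK'.
Qed.

Let e0 : V := delta_mx 0 0.
Let e1 : V := delta_mx 1 0.
(** The form with value [a] at [e0] and [b] at [e1]; it maps the segment between them onto the
    interval between [a] and [b]. *)
Let cov2 a b : 'rV[R]_n.+2 := a *: delta_mx 0 0 + b *: delta_mx 0 1.

Let lcov2 a b (x : V) : lform (cov2 a b) x = a * x 0 0 + b * x 1 0.
Proof. by rewrite lformDl !lformZl /lform -!rowE !mxE. Qed.

Let e00 : e0 0 0 = 1. Proof. by rewrite mxE. Qed.
Let e01 : e0 1 0 = 0. Proof. by rewrite mxE. Qed.
Let e10 : e1 0 0 = 0. Proof. by rewrite mxE. Qed.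
Let e11 : e1 1 0 = 1. Proof. by rewrite mxE. Qed.

(* [truncated_triangle 1] is the segment [e0, e1], and [truncated_triangle 0]
   is the triangle with vertices 0, e0 and e1. *)
Let truncated_triangle (c : R) : set V :=
  closed_box 0 (e0 + e1) `&` [set x | c <= x 0 0 + x 1 0 <= 1].

Lemma closed_box_body (a b : V) : (forall i, a i 0 <= b i 0) ->
  convex_bodies (closed_box a b).
Proof.
move=> ab; split.
- by exists a => i; rewrite lexx ab.
- apply: (@bounded_closed_compact_cV _ _ _ (`|a| + `|b|)).
    have -> : closed_box a b = \bigcap_i [set x : V | a i 0 <= x i 0 <= b i 0].
      by apply/seteqP; split=> x xab => [i _|i]; exact: xab.
    apply: closed_bigI => i _.
    apply: (@closed_preimage _ _ (fun x : V => x i 0) `[a i 0, b i 0]%classic).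
      exact: coord_continuous.
    by apply: interval_closed.
  move=> x i /(_ i) /andP[ax xb].
  have := le_mx_norm a i 0; have := le_mx_norm b i 0.
  by rewrite !ler_norml; lra.
- apply/convex_setP => x y t xab yab t01 i; rewrite !mxE.
  have := xab i; have := yab i; nra.
Qed.

Let triangle_e0 c : c <= 1 -> truncated_triangle c e0.
Proof.
move=> c1; split; last by rewrite /= e00 e01; lra.
by move=> i; rewrite !mxE ler0n lerDl ler0n.
Qed.

Let triangle_e1 c : c <= 1 -> truncated_triangle c e1.
Proof.
move=> c1; split; last by rewrite /= e10 e11; lra.
by move=> i; rewrite !mxE ler0n lerDr ler0n.
Qed.

Let triangle_body c : c <= 1 -> convex_bodies (truncated_triangle c).
Proof.
move=> c1; have [_ cB /convex_setP xB] : convex_bodies (closed_box 0 (e0 + e1)).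
  by apply: closed_box_body => i; rewrite !mxE addr_ge0.
split; first by exists e0; exact: triangle_e0.
- apply: compact_closedI => //.
  apply: (@closed_preimage _ _ (fun x : V => x 0 0 + x 1 0) `[c, 1]%classic).
    move=> x; apply: (@continuousD _ _ _ (fun x : V => x 0 0)
        (fun x : V => x 1 0)); exact: coord_continuous.
  by apply: interval_closed.
- apply/convex_setP => x y t [xB' xc] [yB yc] t01.
  by split; [exact: xB | move: xc yc; rewrite /= !mxE; nra].
Qed.

Let triangleP c x : truncated_triangle c x ->
  [/\ 0 <= x 0 0, 0 <= x 1 0, c <= x 0 0 + x 1 0 & x 0 0 + x 1 0 <= 1].
Proof.
move=> [xB /andP[c1 c2]]; have := xB 0; have := xB 1.
by rewrite !mxE => /andP[x1 _] /andP[x0 _].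
Qed.

(** By [support_eq_range], this is the support value of the image of any body at any form whose
    range on that body is the interval between [a] and [b]. It is a seminorm because [cov2] is
    linear. *)
Let G a b := support (F (truncated_triangle 1)) (cov2 a b).

Let segb := triangle_body (lexx 1).
Let Fseg := Fb segb.

Let GD a b c d : G (a + c) (b + d) <= G a b + G c d.
Proof.
rewrite /G (_ : cov2 _ _ = cov2 a b + cov2 c d).
  exact: supportD (Fcb segb).
by rewrite /cov2 !scalerDl addrACA.
Qed.

Let GZ t a b : G (t * a) (t * b) = `|t| * G a b.
Proof. by rewrite /G -supportZ// /cov2 scalerDr !scalerA. Qed.

Let G_ge0 a b : 0 <= G a b. Proof. exact: support_ge0. Qed.

Let mean_bounds (a b s t : R) : a <= b -> 0 <= s -> 0 <= t -> s + t = 1 ->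
  a <= a * s + b * t <= b.
Proof.
move=> ab s0 t0 st; have -> : t = 1 - s by lra.
have : 0 <= (b - a) * s by rewrite mulr_ge0 ?subr_ge0.
have : 0 <= (b - a) * (1 - s) by rewrite mulr_ge0 ?subr_ge0//; lra.
lra.
Qed.

(** On the segment, [cov2 a b] and [cov2 b a] have the same range, so both orders of the endpoint
    values are allowed. *)
Let support_G_swap K w p q : convex_bodies K -> K p -> K q ->
  (forall x, K x -> lform w p <= lform w x <= lform w q) ->
  support (F K) w = G (lform w p) (lform w q) /\
  support (F K) w = G (lform w q) (lform w p).
Proof.
move=> Kb Kp Kq pq; have /andP[_ ab] := pq p Kp.
have [_ _ cK] := Kb; have [_ _ cS] := segb.
rewrite /G; set a := lform w p in ab *; set b := lform w q in ab *.
have e0S := triangle_e0 (lexx 1); have e1S := triangle_e1 (lexx 1).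
split; apply: support_eq_range => //; rewrite (lform_range cK Kp Kq pq).
  rewrite (lform_range (w := cov2 a b) cS e0S e1S).
    by rewrite !lcov2 e00 e01 e10 e11 !mulr1 !mulr0 addr0 add0r.
  move=> x /triangleP[x0 x1 x2 x3].
  rewrite !lcov2 e00 e01 e10 e11 !mulr1 !mulr0 addr0 add0r.
  by apply: mean_bounds => //; lra.
rewrite (lform_range (w := cov2 b a) cS e1S e0S).
  by rewrite !lcov2 e00 e01 e10 e11 !mulr1 !mulr0 addr0 add0r.
move=> x /triangleP[x0 x1 x2 x3].
rewrite !lcov2 e00 e01 e10 e11 !mulr1 !mulr0 addr0 add0r.
by rewrite addrC; apply: mean_bounds => //; lra.
Qed.

Let support_G K w p q : convex_bodies K -> K p -> K q ->
  (forall x, K x -> lform w p <= lform w x <= lform w q) ->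
  support (F K) w = G (lform w p) (lform w q).
Proof. by move=> Kb Kp Kq pq; have [] := support_G_swap Kb Kp Kq pq. Qed.

Hypothesis Frs : rogers_shephard_type F.

(* Apply the volume inequality to a body in the affine hyperplane [x_0 = 1]. *)
Let G_degenerate : exists a b, [/\ (a != 0) || (b != 0), G a b = 0 & G b a = 0].
Proof.
pose one : V := const_mx 1.
have e0one i : e0 i 0 <= one i 0 by rewrite !mxE; case: eqP.
have Kb := closed_box_body e0one.
have [C C0 /(_ _ Kb) FC] := Frs.
have VK : (Vol (closed_box e0 one) <= 0)%E.
  by apply: (Vol_degenerate_box (i := 0)) => //; rewrite e00 mxE.
have [|w w0 wF] := Vol0_hyperplane (Fb Kb).
  by apply: le_trans FC _; rewrite mule_ge0_le0// lee_fin ltW.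
have [p [q [Kp Kq pq]]] := body_lform_range w Kb.
have [hpq hqp] := support_G_swap Kb Kp Kq pq.
have h0 : support (F (closed_box e0 one)) w = 0.
  by have [x [Fx -> _]] := support_attained w (Fcb Kb); exact: wF.
exists (lform w p), (lform w q); rewrite -hpq -hqp; split=> //.
(* If both endpoint values were 0, [w] would vanish on the box, which contains [e0] and all
   [e0 + delta_mx i 0] with [i != 0]; hence [w] would be 0. *)
rewrite -negb_and; apply: contra w0 => /andP[/eqP p0 /eqP q0].
have wK x : closed_box e0 one x -> lform w x = 0.
  by move=> /pq; rewrite p0 q0; lra.
have wi i : lform w (delta_mx i 0) = w 0 i.
  by rewrite /lform -colE mxE.
have w00 : w 0 0 = 0.
  by rewrite -wi wK// => i; rewrite lexx e0one.
apply/eqP/rowP => i; rewrite mxE; have [->//|i0] := eqVneq i 0.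
rewrite -[LHS]add0r -{1}w00 -!wi -lformD; apply: wK => j; rewrite !mxE.
rewrite lerDl ler0n !andbT /=; have [->|_] := eqVneq j 0.
  by rewrite eq_sym (negbTE i0) addr0 lexx.
by rewrite add0r lern1 leq_b1.
Qed.

(** The kernel of the seminorm contains [(a, b)] and [(b, a)], hence their sum [(a + b)(1, 1)] and
    their difference [(a - b)(1, -1)]. Only the case [a = - b] remains after the first of these. *)
Let G11 : G 1 1 = 0.
Proof.
have [a [b [ab Gab Gba]]] := G_degenerate.
have s0 : `|a + b| * G 1 1 = 0.
  apply/eqP; rewrite eq_le mulr_ge0//= andbT -GZ !mulr1.
  by have := GD a b b a; rewrite Gab Gba addr0 [b + a]addrC.
have d0 : `|a - b| * G 1 (-1) = 0.
  apply/eqP; rewrite eq_le mulr_ge0//= andbT -GZ mulr1 mulrN1 opprB.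
  have := GD a b (- b) (- a); rewrite Gab -[- b]mulN1r -[- a]mulN1r GZ Gba.
  by rewrite mulr0 addr0 !mulN1r.
move/eqP: s0; rewrite mulf_eq0 => /predU1P[/eqP|/eqP//].
rewrite normr_eq0 addr_eq0 => /eqP aNb.
move/eqP: d0; rewrite mulf_eq0 => /predU1P[/eqP|/eqP G1N].
  rewrite normr_eq0 subr_eq0 => /eqP aeb; exfalso; move: ab.
  have -> : a = 0 by lra.
  have -> : b = 0 by lra.
  by rewrite eqxx.
have GN1 : G (-1) 1 = 0.
  by have := GZ (-1) 1 (-1); rewrite mulr1 mulrNN mulr1 G1N mulr0.
(* Convexity of the support function of the image of the triangle excludes a
   nonzero multiple of [|a + b|]. *)
have G01 : G 0 1 = 0.
  have Tb := triangle_body (@ler01 R).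
  have T0 : truncated_triangle 0 0.
    split; last by rewrite /= !mxE; lra.
    by move=> i; rewrite !mxE lexx addr_ge0.
  have Te0 := triangle_e0 (@ler01 R); have Te1 := triangle_e1 (@ler01 R).
  (* On the triangle the forms [(1, 1)], [(0, 2)] and [(-1, 1)] have ranges [[0, 1]], [[0, 2]] and
     [[-1, 1]]. As the second is the sum of the others, [2 * G 0 1 <= G 0 1 + 0]. *)
  have h11 : support (F (truncated_triangle 0)) (cov2 1 1) = G 0 1.
    rewrite (support_G Tb T0 Te0) => [|x /triangleP[]];
      by rewrite !lcov2 e00 e01 !mxE; try congr G; lra.
  have h02 : support (F (truncated_triangle 0)) (cov2 0 2) = G 0 2.
    rewrite (support_G Tb T0 Te1) => [|x /triangleP[]];
      by rewrite !lcov2 e10 e11 !mxE; try congr G; lra.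
  have hN1 : support (F (truncated_triangle 0)) (cov2 (-1) 1) = G (-1) 1.
    rewrite (support_G Tb Te0 Te1) => [|x /triangleP[]];
      by rewrite !lcov2 e00 e01 e10 e11; try congr G; lra.
  have := supportD (cov2 1 1) (cov2 (-1) 1) (Fcb Tb).
  have -> : cov2 1 1 + cov2 (-1) 1 = cov2 0 2.
    by rewrite /cov2 addrACA -!scalerDl subrr.
  rewrite h11 h02 hN1 GN1.
  have -> : G 0 2 = 2 * G 0 1.
    by have := GZ 2 0 1; rewrite mulr0 mulr1 => ->; rewrite ger0_norm.
  by have := G_ge0 0 1; lra.
(* [(1, 1)] is the sum of [(1, -1)] and [(0, 2)], both now in the kernel. *)
have := GD 1 (-1) 0 2; have := GZ 2 0 1; have := G_ge0 1 1.
rewrite G1N G01 !mulr0 mulr1 => h h2; rewrite h2 !addr0.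
have -> : -1 + 2 = 1 :> R by lra.
lra.
Qed.

Lemma symmetrization_difference_body :
  exists2 lambda : R, 0 <= lambda &
    forall K, convex_bodies K -> F K = set_scale lambda (difference_body K).
Proof.
(* For a form with range [[0, 1]] on [K], the difference body has support value 1, which forces this
   factor. *)
exists (G 0 1) => // K Kb.
have [DKb _] := set_scale_difference_body_symmetric (G 0 1) Kb.
apply: eq_support => [||w]; [exact: Fcb | exact: DKb |].
have [p [q [Kp Kq pq]]] := body_lform_range w Kb.
rewrite (support_difference_body Kp Kq)// (support_G Kb Kp Kq pq).
have /andP[_] := pq p Kp; set a := lform w p; set b := lform w q => ab.
have Gd : G 0 (b - a) = G 0 1 * (b - a).
  have := GZ (b - a) 0 1; rewrite mulr0 mulr1 => ->.
  by rewrite ger0_norm ?subr_ge0// mulrC.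
have Gt t : G t t = 0 by have := GZ t 1 1; rewrite mulr1 G11 mulr0.
(* As [(a, a)] lies in the kernel, subadditivity in both directions gives [G a b = G 0 (b - a)]. *)
have := GD a a 0 (b - a); have := GD (- a) (- a) a b.
rewrite !Gt Gd addr0 addNr [- a + b]addrC [a + (b - a)]addrC subrK Gd.
lra.
Qed.

End Characterization.

(** * Multiples of the difference body, and the equivalence *)

Lemma difference_body_properties (R : realType) n (lambda : R)
    (F : set 'cV[R]_n -> set 'cV[R]_n) : (0 < n)%N -> 0 <= lambda ->
  (forall K, convex_bodies K -> F K = set_scale lambda (difference_body K)) ->
  [/\ hausdorff_continuous F, GL_covariant F & rogers_shephard_type F].
Proof.
move=> n0 l0 FE; split.
(* Moving both points of a difference by at most [r] moves its multiple by at most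
   [lambda * (2 * r)]; the [+ 1] covers [lambda = 0]. *)
- move=> K Kb e e0; exists (e / (2 * lambda + 1)) => [|L Lb].
    by rewrite divr_gt0//; lra.
  move=> /(hausdorff_dist_ltP Kb Lb)[r [/andP[r0 re] KL LK]].
  rewrite !FE//; apply: (@hausdorff_dist_lt _ _ _ _ (lambda * (2 * r))).
    rewrite !mulr_ge0//=; move: re; rewrite ltr_pdivlMr; last lra.
    by lra.
  + move=> _ [_ [x Kx [_ [y Ky <-] <-]] <-].
    have [x' Lx' xx'] := KL x Kx; have [y' Ly' yy'] := KL y Ky.
    exists (lambda *: (x' - y')).
      exists (x' - y') => //; exists x' => //; exists (- y') => //.
      by exists y'.
    have -> : lambda *: (x - y) - lambda *: (x' - y') =
        lambda *: ((x - x') - (y - y')).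
      by apply/colP => i; rewrite !mxE; ring.
    exact: euclidean_norm_scaleB.
  + move=> _ [_ [x Kx [_ [y Ky <-] <-]] <-].
    have [x' Lx' xx'] := LK x Kx; have [y' Ly' yy'] := LK y Ky.
    exists (lambda *: (x' - y')).
      exists (x' - y') => //; exists x' => //; exists (- y') => //.
      by exists y'.
    have -> : lambda *: (x - y) - lambda *: (x' - y') =
        lambda *: ((x - x') - (y - y')).
      by apply/colP => i; rewrite !mxE; ring.
    exact: euclidean_norm_scaleB.
- move=> K Kb g _; rewrite !FE//; last exact: convex_body_image.
  apply/seteqP; split.
    move=> _ [_ [_ [x Kx <-] [_ [_ [y Ky <-] <-] <-]] <-].
    exists (lambda *: (x - y)); last by rewrite -scalemxAr mulmxBr.
    by exists (x - y) => //; exists x => //; exists (- y) => //; exists y.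
  move=> _ [_ [_ [x Kx [_ [y Ky <-] <-]] <-] <-].
  exists (g *m x - g *m y); last by rewrite -scalemxAr mulmxBr.
  exists (g *m x); first by exists x.
  by exists (- (g *m y)) => //; exists (g *m y) => //; exists y.
- have [C C0 CK] := difference_body_rogers_shephard lambda n0.
  by exists C => // K Kb; rewrite FE// CK.
Qed.

Theorem corollary1p2 (R : realType) (n : nat) (hn : (2 <= n)%N)
    (diam : {fun @convex_bodies R n >-> @symmetric_convex_bodies R n}) :
  (hausdorff_continuous diam /\ GL_covariant diam /\ rogers_shephard_type diam)
  <->
  (exists2 lambda : R, 0 <= lambda &
     forall K, convex_bodies K -> diam K = set_scale lambda (difference_body K)).
Proof.
have diamS : forall K, convex_bodies K -> symmetric_convex_bodies (diam K).
  by move=> K; exact: funS.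
split=> [[dc [dg drs]]|[lambda l0 dE]]; last first.
  by have [] := difference_body_properties (ltnW hn) l0 dE.
(* The form [n.+2] of the dimension provides the coordinates 0 and 1 that carry the triangle. *)
case: n hn => [//|[//|n]] _ in diam diamS dc dg drs *.
exact: symmetrization_difference_body.
Qed.
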